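(* (1) Let $X$ be a Banach space. If the dual space $X^*$ considered in the weak-star topology is dense-separable, then $X$ has the Countable Separation Property. (2) Suppose that $X_n$, $n<\omega$, are Banach spaces which satisfy Corson's property (C) and have weak-star separable duals. Then the infinite direct sum $\bigoplus_n X_n$ taken in the $c_0$-sense has the Countable Separation Property.
   Context: A topological space is dense-separable if each of its dense subsets is separable. A Banach space $X$ has the Countable Separation Property (CSP) if every family $\mathcal{F}\subset X^*$ of functionals which separates (the points of) $X$ has a countable subfamily $\mathcal{F}_0\subset\mathcal{F}$ which separates $X$. A Banach space $X$ has Corson's property (C) if any collection of closed convex subsets of $X$ with empty intersection has a countable subcollection with empty intersection. The $c_0$-sum $\bigoplus_n X_n$ is the space of sequences $(x_n)$ with $x_n\in X_n$ and $\|x_n\|\to 0$, with norm $\sup_n\|x_n\|$. *)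

(* Defs.v *)
From HB Require Import structures.
From mathcomp Require Import all_boot all_order all_algebra.
From mathcomp Require Import all_classical all_reals all_analysis.
Set Implicit Arguments.
Unset Strict Implicit.
Unset Printing Implicit Defensive.
Import Order.TTheory GRing.Theory Num.Theory.
Import numFieldNormedType.Exports.
Local Open Scope classical_set_scope.
Local Open Scope ring_scope.

Definition separable (T : topologicalType) : Prop :=
  exists2 S : set T, countable S & dense S.

(* [set_type D] carries the subspace topology of [D]. *)
Definition dense_separable (T : topologicalType) : Prop :=
  forall D : set T, dense D -> separable (set_type D).

Record dual (R : realType) (X : normedModType R) := Dual {
  dual_fun :> {linear X -> R^o};
  dual_continuous : continuous dual_fun }.

HB.instance Definition _ (R : realType) (X : normedModType R) :=
  gen_eqMixin (dual X).
HB.instance Definition _ (R : realType) (X : normedModType R) :=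
  gen_choiceMixin (dual X).

(* The coarsest topology on the dual for which all evaluations [f |-> f x] are
   continuous; this is how the library builds its product topology. *)
Definition weak_star (R : realType) (X : normedModType R) : Type := dual X.

HB.instance Definition _ (R : realType) (X : normedModType R) :=
  Topological.copy (weak_star X)
    (sup_topology (fun x : X => Topological.class
       (initial_topology (fun f : dual X => f x : R^o)))).

Definition separates_points (R : realType) (X : normedModType R)
    (F : set (dual X)) : Prop :=
  forall x y : X, x <> y -> exists2 f : dual X, F f & f x <> f y.

Definition countable_separation_property (R : realType)
    (X : completeNormedModType R) : Prop :=
  forall F : set (dual X), separates_points F ->
  exists F0 : set (dual X),
    [/\ F0 `<=` F, countable F0 & separates_points F0].

Definition corson_property_C (R : realType)
    (X : completeNormedModType R) : Prop :=
  forall A : set (set X),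
    (forall C : set X, A C ->
       closed C /\ convex_set (C : set (convex_lmodType X))) ->
    \bigcap_(C in A) C = set0 ->
  exists A0 : set (set X),
    [/\ A0 `<=` A, countable A0 & \bigcap_(C in A0) C = set0].

Record c0_sum (R : realType) (X : nat -> completeNormedModType R) := C0Sum {
  c0_coord :> forall n, X n;
  c0_null : (fun n => `|c0_coord n| : R^o) @ \oo --> (0 : R^o) }.

Section c0_sum_structure.
Context (R : realType) (X : nat -> completeNormedModType R).
Implicit Types x y z : c0_sum X.

Lemma c0_sumP x y : (forall n, x n = y n) -> x = y.
Proof.
case: x y => x xP [y yP] /= xy; have {}xy := functional_extensionality_dep xy.
by subst y; congr C0Sum; exact: Prop_irrelevance.
Qed.

HB.instance Definition _ := gen_eqMixin (c0_sum X).
HB.instance Definition _ := gen_choiceMixin (c0_sum X).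

Let null0 : (fun n => `|0 : X n| : R^o) @ \oo --> (0 : R^o).
Proof.
rewrite (_ : (fun n => _) = cst 0); first exact: cvg_cst.
by apply/funext => n; rewrite normr0.
Qed.

Let nullN x : (fun n => `|- x n| : R^o) @ \oo --> (0 : R^o).
Proof.
rewrite (_ : (fun n => _) = (fun n => `|x n|)); first exact: c0_null.
by apply/funext => n; rewrite normrN.
Qed.

Let nullD x y : (fun n => `|x n + y n| : R^o) @ \oo --> (0 : R^o).
Proof.
apply: (@squeeze_cvgr _ _ _ _ (cst 0) (fun n => `|x n| + `|y n|)).
- by apply: nearW => n /=; rewrite normr_ge0 ler_normD.
- exact: cvg_cst.
- by rewrite -[X in _ --> X]addr0; apply: cvgD; exact: c0_null.
Qed.

Let nullZ (a : R) x : (fun n => `|a *: x n| : R^o) @ \oo --> (0 : R^o).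
Proof.
rewrite (_ : (fun n => _) = (fun n => `|a| * `|x n|)); last first.
  by apply/funext => n; rewrite normrZ.
by rewrite -[X in _ --> X](mulr0 `|a|); apply: cvgMr; exact: c0_null.
Qed.

Let zero := C0Sum null0.
Let opp x := C0Sum (nullN x).
Let add x y := C0Sum (nullD x y).
Let scale (a : R) x := C0Sum (nullZ a x).

Let addA : associative add.
Proof. by move=> x y z; apply: c0_sumP => n /=; rewrite addrA. Qed.
Let addC : commutative add.
Proof. by move=> x y; apply: c0_sumP => n /=; rewrite addrC. Qed.
Let add0 : left_id zero add.
Proof. by move=> x; apply: c0_sumP => n /=; rewrite add0r. Qed.
Let addN : left_inverse zero opp add.
Proof. by move=> x; apply: c0_sumP => n /=; rewrite addNr. Qed.

HB.instance Definition _ :=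
  GRing.isZmodule.Build (c0_sum X) addA addC add0 addN.

Let scaleA a b x : scale a (scale b x) = scale (a * b) x.
Proof. by apply: c0_sumP => n /=; rewrite scalerA. Qed.
Let scale1 : left_id 1 scale.
Proof. by move=> x; apply: c0_sumP => n /=; rewrite scale1r. Qed.
Let scaleDr : right_distributive scale +%R.
Proof. by move=> a x y; apply: c0_sumP => n /=; rewrite scalerDr. Qed.
Let scaleDl x : {morph scale^~ x : a b / a + b >-> a + b}.
Proof. by move=> a b; apply: c0_sumP => n /=; rewrite scalerDl. Qed.

HB.instance Definition _ := GRing.Zmodule_isLmodule.Build R (c0_sum X)
  scaleA scale1 scaleDr scaleDl.

Definition c0_norm x : R := sup (range (fun n => `|x n|)).

Let norm_has_sup x : has_sup (range (fun n => `|x n| : R)).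
Proof.
split; first by exists `|x 0|, 0%N.
have cx : cvgn (fun n => `|x n| : R^o) by apply/cvg_ex; exists 0; exact: c0_null.
have [M [_ Mx]] := cvg_seq_bounded cx.
exists (M + 1) => _ [n _ <-].
by rewrite -[leLHS]normr_id; apply: (Mx (M + 1)) => //; rewrite ltrDl.
Qed.

Let norm_ub x n : `|x n| <= c0_norm x.
Proof. by apply: ub_le_sup; [case: (norm_has_sup x)|exists n]. Qed.

Let norm_le x M : (forall n, `|x n| <= M) -> c0_norm x <= M.
Proof.
move=> xM; apply: ge_sup; first by case: (norm_has_sup x).
by move=> _ [n _ <-].
Qed.

Let normD x y : c0_norm (x + y) <= c0_norm x + c0_norm y.
Proof.
by apply: norm_le => n; rewrite (le_trans (ler_normD _ _))// lerD.
Qed.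

Let norm_eq0 x : c0_norm x = 0 -> x = 0.
Proof.
move=> x0; apply: c0_sumP => n; apply/eqP; rewrite -normr_le0 -x0.
exact: norm_ub.
Qed.

Let normZ (a : R) x : c0_norm (a *: x) = `|a| * c0_norm x.
Proof.
have le b z : c0_norm (b *: z) <= `|b| * c0_norm z.
  by apply: norm_le => n; rewrite normrZ ler_wpM2l//; exact: norm_ub.
apply/le_anti; rewrite le /=.
have [->|a0] := eqVneq a 0.
  by rewrite normr0 mul0r (le_trans (normr_ge0 _) (norm_ub _ 0%N)).
rewrite -ler_pdivlMl ?normr_gt0// -normfV -{1}[x]scale1r -(mulVf a0).
by rewrite -scalerA le.
Qed.

HB.instance Definition _ :=
  Lmodule_isNormed.Build R (c0_sum X) normD normZ norm_eq0.

Lemma c0_normE x : `|x| = sup (range (fun n => `|x n|)).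
Proof. by []. Qed.

Lemma c0_coord_le_norm x n : `|x n| <= `|x|.
Proof. exact: norm_ub. Qed.

Lemma c0_norm_le x (M : R) : (forall n, `|x n| <= M) -> `|x| <= M.
Proof. exact: norm_le. Qed.

Let complete (F : set_system (c0_sum X)) :
  ProperFilter F -> cauchy F -> cvg F.
Proof.
move=> FF /cauchy_ballP Fc.
have Fn n : cvg ((fun x => x n) @ F).
  pose G := (fun x => x n) @ F.
  have GF : ProperFilter G by exact: fmap_proper_filter.
  apply: (@cauchy_cvg _ G GF); apply/cauchy_ballP => e e0.
  have ball_coord x y : ball x e y -> ball (x n) e (y n).
    rewrite -!ball_normE /=; apply: le_lt_trans.
    exact: (c0_coord_le_norm (x - y)).
  by rewrite near_map2; near do apply: ball_coord; exact: Fc.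
pose l n : X n := lim ((fun x => x n) @ F).
have Fl (e : R) : 0 < e -> F [set x | forall n, `|l n - c0_coord x n| <= e].
  move=> e0; have e20 : 0 < e / 2 by rewrite divr_gt0.
  have [A FA AA] : exists2 A, F A & forall x y, A x -> A y -> `|x - y| < e / 2.
    have [[A B] [FA FB] AB] := Fc _ e20.
    exists (A `&` B); first exact: filterI.
    move=> x y [Ax _] [_ By]; have := AB (x, y) (conj Ax By).
    by rewrite -ball_normE.
  apply: (filterS _ FA) => x Ax n.
  have /cvgrPdist_lt /(_ _ e20) Fln : (fun z : c0_sum X => z n) @ F --> l n.
    exact: Fn.
  near F => y.
  have Ay : A y by near: y.
  rewrite (splitr e) -(subrK (y n) (l n)) -addrA (le_trans (ler_normD _ _))//.
  rewrite lerD//; first by apply: ltW; near: y.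
  by rewrite (le_trans (c0_coord_le_norm (y - x) n))// ltW// AA.
have l_null : (fun n => `|l n| : R^o) @ \oo --> (0 : R^o).
  apply/cvgrPdist_le => e e0; have e20 : 0 < e / 2 by rewrite divr_gt0.
  have [x xl] := filter_ex (Fl _ e20).
  have /cvgrPdist_le /(_ _ e20) := c0_null x.
  apply: filterS => n; rewrite !sub0r !normrN !normr_id => xn.
  by rewrite (splitr e) -(subrK (x n) (l n)) (le_trans (ler_normD _ _))// lerD.
apply/cvg_ex; exists (C0Sum l_null); apply/cvgrPdist_le => e e0.
by apply: filterS (Fl _ e0) => x xl; exact: c0_norm_le.
Unshelve. all: by end_near. Qed.

HB.instance Definition _ := Uniform_isComplete.Build (c0_sum X) complete.

End c0_sum_structure.

(* Main.v *)
Require Import Defs.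
From HB Require Import structures.
From mathcomp Require Import all_boot all_order all_algebra.
From mathcomp Require Import all_classical all_reals all_analysis.
Set Implicit Arguments.
Unset Strict Implicit.
Unset Printing Implicit Defensive.
Import Order.TTheory GRing.Theory Num.Theory.
Import numFieldNormedType.Exports.
Local Open Scope classical_set_scope.
Local Open Scope ring_scope.

(** Part (1). If a family F separates the points of X, then its linear span is
weak-star dense: a weak-star neighbourhood of g only constrains the values at
finitely many points, and elementary linear algebra finds a member of the span
with the same values as g there ([separating_interpolation]).
Dense-separability then provides countably many members of the span that are
still weak-star dense.  Each of them involves only finitely many members of F,
and these members, countably many in all, separate points, because a weak-star
dense set of functionals separates every pair of points that some functional
separates ([weak_star_dense_separates]).

Part (2). If X has property (C) and some countable set S of functionals
separates its points, then X has the Countable Separation Property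
([csp_of_property_C]).  Indeed the half-spaces where z g >= 1, for g in S and z
an integer, are countably many closed convex sets that cover X minus the origin
and miss the origin.  Given a separating family F, each half-space H has no
common point with all the kernels of the members of F, so by (C) it already
misses the common zeros of countably many of them; the union over all H is the
countable subfamily.

So it remains to see that the c0-sum has (C) and a countable separating set of
functionals.  For the latter, a countable weak-star dense set in each dual of
X_n, composed with the coordinate map, works: it separates the points of X_n
because the restrictions of the members of F do.

For (C) ([c0_sum_property_C]), replace a family of closed convex sets with the
countable intersection property by the family A of all its countable
intersections; then any countably many members of A contain a common member
([sigma_directed]).  Fix e > 0.  There is one n such that every member of A has
a point whose coordinates from n on are at most e: otherwise choose a bad
member for each n, and any point of a common lower bound would fail to tend to
0.  Property (C) of X_0, ..., X_(n-1) gives one coordinate at a time a finitely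
supported point lying within e of every member of A.  Cutting A down to a small
ball around that point and repeating with smaller e, completeness yields a
point in all members of A ([convex_base_bigcap]). *)

(** * Convex sets and countable subfamilies *)

(** Choosing one preimage of each point turns a countable family obtained from
property (C) back into countably many of the original objects. *)
Lemma countable_sub_image T U (f : T -> U) (A : set T) (D : set U) :
  D `<=` f @` A -> countable D ->
  exists D' : set T, [/\ D' `<=` A, countable D' & f @` D' = D].
Proof.
move=> DA cD; have [->|/set0P[u Du]] := eqVneq D set0.
  by exists set0; split; [|exact: countable0|rewrite image_set0].
have [a0 _ _] := DA u Du.
have [k kP] : {k : U -> T & forall u, D u -> A (k u) /\ f (k u) = u}.
  apply: (@choice _ _ (fun u x => D u -> A x /\ f x = u)) => v.
  by have [/DA[x Ax <-]|] := pselect (D v); [exists x|exists a0].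
exists (k @` D); split.
- by move=> _ [v Dv <-]; have [] := kP v Dv.
- exact: sub_countable (card_image_le _ _) cD.
apply/seteqP; split=> [_ [_ [v Dv <-] <-]|v Dv].
  by have [_ ->] := kP v Dv.
by exists (k v); [exists v|have [] := kP v Dv].
Qed.

Section convexity.
Context (R : realType).

Lemma convex_setE (V : lmodType R) (A : set V) :
  convex_set (A : set (convex_lmodType V)) <->
  forall x y (t : R), 0 <= t -> t <= 1 -> A x -> A y ->
    A (t *: x + (1 - t) *: y).
Proof.
split => [cA x y t t0 t1 Ax Ay|cA x y l /set_mem Ax /set_mem Ay].
  by apply/set_mem/(cA x y (Itv01 t0 t1)); exact/mem_set.
by apply/mem_set/cA.
Qed.

Lemma norm_conv_le (V : normedModType R) (a b : V) (t e : R) :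
  0 <= t -> t <= 1 -> `|a| <= e -> `|b| <= e ->
  `|t *: a + (1 - t) *: b| <= e.
Proof.
move=> t0 t1 ae be; have s0 : 0 <= 1 - t by rewrite subr_ge0.
rewrite (le_trans (ler_normD _ _))// !normrZ (ger0_norm t0) (ger0_norm s0).
rewrite (_ : e = t * e + (1 - t) * e); last first.
  by rewrite -mulrDl addrC subrK mul1r.
by rewrite lerD// ler_wpM2l.
Qed.

Lemma convex_setI (V : lmodType R) (A B : set V) :
  convex_set (A : set (convex_lmodType V)) ->
  convex_set (B : set (convex_lmodType V)) ->
  convex_set (A `&` B : set (convex_lmodType V)).
Proof.
move=> /convex_setE cA /convex_setE cB; apply/convex_setE.
by move=> x y t t0 t1 [Ax Bx] [Ay By]; split; [exact: cA|exact: cB].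
Qed.

Lemma convex_bigcap (V : lmodType R) (F : set (set V)) :
  (forall C, F C -> convex_set (C : set (convex_lmodType V))) ->
  convex_set (\bigcap_(C in F) C : set (convex_lmodType V)).
Proof.
move=> cF; apply/convex_setE => x y t t0 t1 Fx Fy C FC.
by move: (cF C FC) => /convex_setE; apply => //; [exact: Fx|exact: Fy].
Qed.

Lemma closure_normP (V : normedModType R) (A : set V) x :
  closure A x <-> forall e : R, 0 < e -> exists2 a, A a & `|a - x| <= e.
Proof.
split=> [Ax e e0|Ax U /nbhs_normP[e e0 eU]].
  have [a [Aa]] := Ax _ (nbhsx_ballx x e e0).
  by rewrite -ball_normE /= distrC => /ltW; exists a.
have [a Aa ax] := Ax (e / 2) (divr_gt0 e0 (ltr0n _ 2)).
exists a; split => //; apply: eU => /=; rewrite distrC (le_lt_trans ax)//.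
by rewrite gtr_pMr// invf_lt1// ltr1n.
Qed.

Lemma convex_closure (V : normedModType R) (A : set V) :
  convex_set (A : set (convex_lmodType V)) ->
  convex_set (closure A : set (convex_lmodType V)).
Proof.
move=> /convex_setE cA; apply/convex_setE => x y t t0 t1.
move=> /closure_normP Ax /closure_normP Ay; apply/closure_normP => e e0.
have [a Aa ax] := Ax e e0; have [b Ab by_] := Ay e e0.
exists (t *: a + (1 - t) *: b); first exact: cA.
by rewrite opprD addrACA -!scalerBr norm_conv_le.
Qed.

Lemma convex_image (V W : lmodType R) (f : {linear V -> W}) (A : set V) :
  convex_set (A : set (convex_lmodType V)) ->
  convex_set (f @` A : set (convex_lmodType W)).
Proof.
move=> /convex_setE cA; apply/convex_setE => _ _ t t0 t1 [x Ax <-] [y Ay <-].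
by exists (t *: x + (1 - t) *: y); [exact: cA|rewrite linearD !linearZ].
Qed.

Lemma convex_normB_le (V : lmodType R) (W : normedModType R)
    (f : {linear V -> W}) (w : W) (e : R) :
  convex_set ([set x | `|f x - w| <= e] : set (convex_lmodType V)).
Proof.
apply/convex_setE => x y t t0 t1 /= xe ye; rewrite linearD !linearZ /=.
rewrite [X in _ - X](_ : w = t *: w + (1 - t) *: w); last first.
  by rewrite -scalerDl addrC subrK scale1r.
by rewrite opprD addrACA -!scalerBr norm_conv_le.
Qed.

End convexity.

(** * Property (C) in terms of countably directed families *)

Section convex_base.
Context (R : realType).

(** Taking [D] empty shows that such a family is nonempty. *)
Definition sigma_directed T (A : set (set T)) :=
  forall D, D `<=` A -> countable D ->
  exists2 C, A C & forall B, D B -> C `<=` B.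

Definition convex_base (V : lmodType R) (A : set (set V)) :=
  sigma_directed A /\
  forall C, A C -> convex_set (C : set (convex_lmodType V)) /\ C !=set0.

Definition trace T (A : set (set T)) (K : set T) := [set C `&` K | C in A].

(** The trace records the choices made so far: each further approximation is
carried out inside it, so that it stays compatible with the earlier ones. *)
Lemma convex_base_trace (V : lmodType R) (A : set (set V)) (K : set V) :
  convex_base A -> convex_set (K : set (convex_lmodType V)) ->
  (forall C, A C -> C `&` K !=set0) -> convex_base (trace A K).
Proof.
move=> [dA cA] cK AK; split; last first.
  move=> _ [C AC <-]; split; last exact: AK.
  by apply: convex_setI => //; have [] := cA _ AC.
move=> D DA cD.
have [D' [D'A cD' D'D]] := countable_sub_image DA cD.
have [C AC CP] := dA D' D'A cD'; exists (C `&` K); first by exists C.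
by rewrite -D'D => _ [B D'B <-]; apply: setSI; exact: CP.
Qed.

(** The closures of the images are closed convex subsets of [Y], and countably
many of them have a common point, namely any image of a point of a common lower
bound; so property (C) applies. *)
Lemma convex_base_image_closure (V : lmodType R) (Y : completeNormedModType R)
    (f : {linear V -> Y}) (A : set (set V)) :
  corson_property_C Y -> convex_base A ->
  exists y, forall C, A C -> closure (f @` C) y.
Proof.
move=> CY [dA cA]; apply: contrapT => noy.
pose cl C := closure (f @` C).
have [||A0 [A0A cA0 A00]] := CY (cl @` A).
- move=> _ [C AC <-]; split; first exact: closed_closure.
  by apply/convex_closure/convex_image; have [] := cA _ AC.
- apply/seteqP; split => // y Ay; apply: noy; exists y => C AC.
  by apply: (Ay (cl C)); exists C.
have [D [DA cD DA0]] := countable_sub_image A0A cA0.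
have [C AC CP] := dA D DA cD; have [x Cx] := (cA _ AC).2.
suff : (\bigcap_(B in A0) B) (f x) by rewrite A00.
rewrite -DA0 => _ [B DB <-]; apply: subset_closure.
by exists x => //; exact: CP DB _ Cx.
Qed.

(** Approximate common points suffice.  The sets [P k] are convex, decreasing
and of diameter at most [1/k], and every member of [A] meets all of them; the
traces of [A] on the [P k] generate a Cauchy filter, whose limit belongs to
every member of [A]. *)
Lemma convex_base_bigcap (Z : completeNormedModType R) (A : set (set Z)) :
  (forall A' : set (set Z), convex_base A' -> forall e : R, 0 < e ->
    exists z, forall C, A' C -> exists2 c, C c & `|c - z| <= e) ->
  convex_base A -> (forall C, A C -> closed C) -> \bigcap_(C in A) C !=set0.
Proof.
move=> near bA clA.
pose good (P : set Z) := convex_set (P : set (convex_lmodType Z)) /\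
  forall C, A C -> C `&` P !=set0.
have step (kP : nat * set Z) : exists Q, good kP.2 ->
    [/\ good Q, Q `<=` kP.2 &
     forall x y, Q x -> Q y -> `|x - y| <= kP.1.+1%:R^-1].
  case: kP => k P /=; have [gP|?] := pselect (good P); last by exists set0.
  pose e : R := k.+1%:R^-1 / 2.
  have e0 : 0 < e by rewrite divr_gt0// invr_gt0 ltr0n.
  have [z zP] := near _ (convex_base_trace bA gP.1 gP.2) _ e0.
  (* [idfun] presents the ball as a preimage under a linear map *)
  exists (P `&` [set x | `|idfun x - z| <= e]) => _; split.
  - split; first by apply: convex_setI gP.1 _; exact: convex_normB_le.
    move=> C AC; have [|c [Cc Pc] cz] := zP (C `&` P); first by exists C.
    by exists c.
  - by move=> x [].
  - move=> x y [_ /= xz] [_ /= yz]; rewrite (splitr k.+1%:R^-1).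
    rewrite -(subrK z x) -addrA (le_trans (ler_normD _ _))// lerD//.
    by rewrite distrC.
have {}[Q QP] := choice step.
pose P := fix P k := if k is k'.+1 then Q (k', P k') else [set: Z].
have gP k : good (P k).
  elim: k => [|k IH] /=; last by have [] := QP (k, P k) IH.
  split=> [|C AC]; first by apply/convex_setE.
  by rewrite setIT; have [] := bA.2 _ AC.
have decP k l : (k <= l)%N -> P l `<=` P k.
  move=> /subnK <-; elim: (l - k)%N => // m IH.
  by have [_ sub _] := QP ((m + k)%N, P (m + k)%N) (gP _) => x /sub/IH.
have smallP k x y : P k.+1 x -> P k.+1 y -> `|x - y| <= k.+1%:R^-1.
  by have [_ _ +] := QP (k, P k) (gP k); exact.
have A2 C D : A C -> A D -> exists2 B, A B & B `<=` C `&` D.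
  move=> AC AD; have [||B AB BP] := bA.1 [set C; D].
  - by move=> _ [->|->].
  - exact/finite_set_countable/finite_set2.
  by exists B => // x Bx; split; apply: (BP _ _ _ Bx); [left|right].
pose G := filter_from [set Ck : set Z * nat | A Ck.1]
  (fun Ck => Ck.1 `&` P Ck.2).
have GG : ProperFilter G.
  apply: filter_from_proper; last by move=> [C k] /= AC; exact: (gP k).2.
  apply: filter_from_filter.
    have [||C AC _] := bA.1 set0; [by []|exact: countable0|by exists (C, 0%N)].
  move=> [C k] [D l] /= AC AD; have [B AB BCD] := A2 _ _ AC AD.
  exists (B, maxn k l) => //= x [/BCD[Cx Dx] Px]; split; split => //.
    by apply: decP Px; rewrite leq_maxl.
  by apply: decP Px; rewrite leq_maxr.
have Gc : cauchy G.
  apply/cauchy_ballP => e e0.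
  have [k /= ke] : exists k, k.+1%:R^-1 < e.
    have [N _ /(_ N (leqnn N)) Ne] := near_infty_natSinv_lt (PosNum e0).
    by exists N.
  have [||C AC _] := bA.1 set0; [by []|exact: countable0|].
  have GP : G (P k.+1) by exists (C, k.+1) => //= x [].
  exists (P k.+1, P k.+1); first by [].
  move=> [x y] [/= Px Py]; rewrite -ball_normE /=.
  exact: le_lt_trans (smallP _ _ _ Px Py) ke.
have [l Gl] : exists l : Z, G --> l by apply/cvg_ex; exact: cauchy_cvg Gc.
exists l; move=> C AC.
apply: (@closed_cvg _ _ G _ (fun x => x) _ (clA _ AC) _ _ Gl).
by exists (C, 0%N) => //= x [].
Qed.

(** If no countable subfamily of [A] had empty intersection, the countable
intersections of members of [A] would form a convex base, and a point common to
all of these would lie in every member of [A]. *)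
Lemma property_C_of_convex_base (Z : completeNormedModType R) :
  (forall A : set (set Z), convex_base A -> (forall C, A C -> closed C) ->
    \bigcap_(C in A) C !=set0) ->
  corson_property_C Z.
Proof.
move=> meets A cA A0; apply: contrapT => noA0.
pose B := [set \bigcap_(C in D) C | D in [set D | D `<=` A /\ countable D]].
have [||z Bz] := meets B.
- split.
    move=> D DB cD.
    have [E [EA cE <-]] := countable_sub_image DB cD.
    exists (\bigcap_(C in \bigcup_(d in E) d) C).
      exists (\bigcup_(d in E) d) => //; split.
        by move=> C [d Ed dC]; have [dA _] := EA _ Ed; exact: dA.
      by apply: bigcup_countable => // d /EA[].
    by move=> _ [d Ed <-] x Ex C dC; apply: Ex; exists d.
  move=> _ [D [DA cD] <-]; split.
    by apply: convex_bigcap => C /DA /cA[].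
  by apply/set0P/eqP => D0; apply: noA0; exists D.
- move=> _ [D [DA cD] <-]; apply: closed_bigI.
  by move=> C /DA /cA[].
suff : (\bigcap_(C in A) C) z by rewrite A0.
move=> C AC; apply: Bz; exists [set C]; last exact: bigcap_set1.
by split; [move=> _ ->|exact: countable1].
Qed.

End convex_base.

(** * The c0-sum inherits property (C) *)

Lemma nonexpansive_continuous (R : realType) (V W : normedModType R)
    (f : {linear V -> W}) :
  (forall x, `|f x| <= `|x|) -> continuous f.
Proof.
move=> fle x; apply/cvgrPdist_le => e e0.
have /cvgrPdist_le/(_ _ e0) : y @[y --> x] --> x by exact: cvg_id.
by apply: filterS => y; rewrite -linearB; exact: le_trans.
Qed.

Section c0_sum_coordinates.
Context (R : realType) (X : nat -> completeNormedModType R).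
Implicit Types (n : nat).

Lemma c0_coordD (x y : c0_sum X) n : (x + y) n = x n + y n.
Proof. by []. Qed.

Lemma c0_coordB (x y : c0_sum X) n : (x - y) n = x n - y n.
Proof. by []. Qed.

Lemma c0_coordZ (t : R) (x : c0_sum X) n : (t *: x) n = t *: x n.
Proof. by []. Qed.

Lemma c0_coord0 n : (0 : c0_sum X) n = 0.
Proof. by []. Qed.

Definition c0_proj n (x : c0_sum X) : X n := x n.

Let c0_proj_linear n : linear (c0_proj n).
Proof. by []. Qed.

HB.instance Definition _ n :=
  GRing.isLinear.Build R (c0_sum X) (X n) *:%R (c0_proj n) (c0_proj_linear n).

Lemma c0_proj_continuous n : continuous (c0_proj n).
Proof. by apply: nonexpansive_continuous => x; exact: c0_coord_le_norm. Qed.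

Let single_fun n (a : X n) : forall m, X m := dfwith (fun m => 0 : X m) n a.

Let single_null n (a : X n) :
  (fun m => `|single_fun a m| : R^o) @ \oo --> (0 : R^o).
Proof.
apply: cvg_near_cst; exists n.+1 => // m /= nm.
by rewrite /single_fun dfwithout ?normr0// neq_ltn nm.
Qed.

Definition c0_single n (a : X n) : c0_sum X := C0Sum (single_null a).

Lemma c0_single_in n (a : X n) : c0_single a n = a.
Proof. exact: dfwithin. Qed.

Lemma c0_single_out n (a : X n) m : n != m -> c0_single a m = 0.
Proof. exact: dfwithout. Qed.

Let c0_single_linear n : linear (@c0_single n).
Proof.
move=> t a b; apply: c0_sumP => m.
rewrite c0_coordD c0_coordZ.
have [<-|nm] := eqVneq n m; first by rewrite !c0_single_in.
by rewrite !c0_single_out// scaler0 addr0.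
Qed.

HB.instance Definition _ n := GRing.isLinear.Build R (X n) (c0_sum X) *:%R
  (@c0_single n) (@c0_single_linear n).

Lemma c0_single_continuous n : continuous (@c0_single n).
Proof.
apply: nonexpansive_continuous => a; apply: c0_norm_le => m.
have [<-|nm] := eqVneq n m; first by rewrite c0_single_in.
by rewrite c0_single_out// normr0.
Qed.

Lemma convex_coords_near (M : set nat) (y : c0_sum X) (e : R) :
  convex_set ([set c : c0_sum X | forall m, M m -> `|c m - y m| <= e]
    : set (convex_lmodType (c0_sum X))).
Proof.
apply/convex_setE => a b t t0 t1 /= ae be m Mm.
have /convex_setE := @convex_normB_le _ _ _ (c0_proj m) (y m) e.
by apply => //; [exact: ae|exact: be].
Qed.

(** The coordinates of [y] are found one after the other: the family is cut
down to the points that are close to the coordinates already chosen, and the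
next one is a common point of the closures of the projections, which property
(C) of that summand provides. *)
Lemma near_finitely_many_coords (A : set (set (c0_sum X))) (e : R) k :
  (forall n, corson_property_C (X n)) -> 0 < e -> convex_base A ->
  exists y : c0_sum X, (forall m, (k <= m)%N -> y m = 0) /\
    forall C, A C -> exists2 c, C c & forall m, (m < k)%N -> `|c m - y m| <= e.
Proof.
move=> CX e0 bA; elim: k => [|k [y [y0 yA]]].
  by exists 0; split => // C AC; have [c Cc] := (bA.2 _ AC).2; exists c.
pose K := [set c : c0_sum X | forall m, (m < k)%N -> `|c m - y m| <= e].
have bAK : convex_base (trace A K).
  apply: convex_base_trace => //; first exact: (@convex_coords_near `I_k).
  by move=> C AC; have [c Cc cy] := yA _ AC; exists c.
have [x xP] := convex_base_image_closure (c0_proj k) (CX k) bAK.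
exists (y + c0_single x); split => [m km|C AC].
  by rewrite c0_coordD y0 1?ltnW// c0_single_out ?add0r// ltn_eqF.
have /closure_normP/(_ _ e0) : closure (c0_proj k @` (C `&` K)) x.
  by apply: xP; exists C.
move=> [_ [c [Cc Kc] <-] cx]; exists c => // m; rewrite ltnS leq_eqVlt.
rewrite c0_coordD => /predU1P[->|mk].
  by rewrite y0// add0r c0_single_in.
by rewrite c0_single_out ?addr0; [exact: Kc|rewrite gtn_eqF].
Qed.

Lemma c0_sum_property_C :
  (forall n, corson_property_C (X n)) -> corson_property_C (c0_sum X).
Proof.
move=> CX; apply: property_C_of_convex_base => A bA clA.
apply: convex_base_bigcap clA => // {bA}A bA e e0.
(* a single [n] serves all members: one bad member for each [n] would have a
   common lower bound, and its points would not tend to 0 *)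
have [n nP] : exists n, forall C, A C ->
    exists2 c, C c & forall m, (n <= m)%N -> `|c m| <= e.
  apply: contrapT => /forallNP no.
  have {}[C CP] : {C : nat -> set (c0_sum X) & forall n, A (C n) /\
      forall c, C n c -> ~ forall m, (n <= m)%N -> `|c m| <= e}.
    apply: (@choice _ _ (fun n C => A C /\
      forall c, C c -> ~ forall m, (n <= m)%N -> `|c m| <= e)) => n.
    have /existsNP[C /not_implyP[AC CP]] := no n.
    by exists C; split => // c Cc ce; apply: CP; exists c.
  have [||D AD DC] := bA.1 (range C).
  - by move=> _ [n _ <-]; have [] := CP n.
  - exact: sub_countable (card_image_le _ _) _.
  have [c Dc] := (bA.2 _ AD).2.
  have /cvgrPdist_le/(_ _ e0)[n _ nc] := c0_null c.
  apply: ((CP n).2 c); first by apply: DC Dc; exists n.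
  by move=> m nm; have := nc m nm; rewrite /= sub0r normrN normr_id.
pose K :=
  [set c : c0_sum X | forall m, (n <= m)%N -> `|c m - (0 : c0_sum X) m| <= e].
have bAK : convex_base (trace A K).
  apply: convex_base_trace => //.
    exact: (@convex_coords_near [set m | (n <= m)%N]).
  move=> C AC; have [c Cc cP] := nP _ AC; exists c; split => // m nm.
  by rewrite c0_coord0 subr0; exact: cP.
have [y [y0 yA]] := near_finitely_many_coords n CX e0 bAK.
exists y => C AC; have [|c [Cc Kc] cy] := yA (C `&` K); first by exists C.
exists c => //; apply: c0_norm_le => m; rewrite c0_coordB.
have [nm|mn] := leqP n m; last exact: cy.
by rewrite y0//; exact: Kc.
Qed.

End c0_sum_coordinates.

(** * Functionals and the weak-star topology *)

Section dual_constructions.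
Context (R : realType).

Lemma dual_comp_continuous (X Y : normedModType R) (g : dual Y)
    (p : {linear X -> Y}) : continuous p -> continuous (g \o p).
Proof.
by move=> pc x; apply: continuous_comp; [exact: pc|exact: dual_continuous].
Qed.

Definition dual_comp (X Y : normedModType R) (g : dual Y) (p : {linear X -> Y})
  (pc : continuous p) : dual X := @Dual _ _ (g \o p) (dual_comp_continuous pc).

Lemma dual_lincomb_continuous (X : normedModType R) (t : R) (h k : dual X) :
  continuous ((t \*: dual_fun h) \+ dual_fun k).
Proof.
move=> x; apply: cvgD; last exact: dual_continuous.
by apply: cvgZl_tmp; exact: dual_continuous.
Qed.

Definition dual_lincomb (X : normedModType R) (t : R) (h k : dual X) : dual X :=
  @Dual _ _ ((t \*: dual_fun h) \+ dual_fun k)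
    (@dual_lincomb_continuous X t h k).

Lemma dual_lincombE (X : normedModType R) (t : R) (h k : dual X) x :
  dual_lincomb t h k x = t * h x + k x.
Proof. by []. Qed.

End dual_constructions.

Section weak_star.
Context (R : realType).

Lemma separates_pointsP (X : normedModType R) (F : set (dual X)) :
  separates_points F <-> forall x, x <> 0 -> exists2 f, F f & f x <> 0.
Proof.
split=> [sF x x0|sF x y xy].
  by have [f Ff fx] := sF x 0 x0; exists f => //; rewrite linear0 in fx.
have [|f Ff fxy] := sF (x - y); first by move/subr0_eq.
by exists f => // fE; apply: fxy; rewrite linearB fE; exact: subrr.
Qed.

Lemma weak_star_eval_continuous (X : normedModType R) (x : X) :
  continuous (fun f : weak_star X => (f : dual X) x : R^o).
Proof.
move=> f.
have /cvg_sup/(_ x) ff : nbhs f --> (f : weak_star X) by exact: cvg_id.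
move=> U /(@initial_continuous _ _ (fun h : dual X => h x : R^o) f).
exact: ff.
Qed.

Lemma open_weak_star_neq0 (X : normedModType R) (x : X) :
  open [set f : weak_star X | (f : dual X) x <> 0].
Proof.
have /continuousP := @weak_star_eval_continuous X x.
move=> /(_ [set r : R^o | r != 0]) /(_ (@open_neq R 0)).
by congr open; apply/seteqP; split=> f /eqP.
Qed.

(** The condition [f x <> 0] is weak-star open, and holds for some [f] in [F]
when [x] is not 0, so that a dense set meets it. *)
Lemma weak_star_dense_separates (X : normedModType R) (F S : set (dual X)) :
  separates_points F -> dense (S : set (weak_star X)) -> separates_points S.
Proof.
move=> /separates_pointsP sF dS; apply/separates_pointsP => x x0.
have [f Ff fx] := sF x x0.
have [||g [gx Sg]] := dS [set f : weak_star X | (f : dual X) x <> 0].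
- by exists f.
- exact: open_weak_star_neq0.
- by exists g.
Qed.

(** * Separating subspaces of the dual are weak-star dense *)

Section interpolation.
Context (X : normedModType R) (W : set (dual X)).
Context (Wlincomb : forall t h k, W h -> W k -> W (dual_lincomb t h k)).
Context (Wsep : separates_points W).

(** This is the statement that [x] lies in the span of [ys], phrased through
functionals: if it holds for [W], separation forces it for the whole dual.  In
the induction, when some [k] in [W] vanishes on [ys] but not at [y], the vector
[x - (k x / k y) y] takes the place of [x]. *)
Lemma separating_annihilator (ys : seq X) (x : X) :
  (forall h, W h -> {in ys, forall y, h y = 0} -> h x = 0) ->
  forall g : dual X, {in ys, forall y, g y = 0} -> g x = 0.
Proof.
elim: ys x => [|y ys IH] x Wx g gys.
  have [->|/eqP x0] := eqVneq x 0; first exact: linear0.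
  have /separates_pointsP/(_ x x0)[h Wh] := Wsep.
  by rewrite Wx.
have gy : g y = 0 by apply: gys; rewrite mem_head.
have {}gys : {in ys, forall z, g z = 0}.
  by move=> z zys; apply: gys; rewrite in_cons zys orbT.
have [[k Wk [kys ky]]|nok] := pselect (exists2 k, W k &
    {in ys, forall z, k z = 0} /\ k y <> 0); last first.
  apply: IH gys => h Wh hys; apply: Wx => // z; rewrite in_cons.
  move=> /predU1P[->|]; last exact: hys.
  by apply: contrapT => hy; apply: nok; exists h.
have /eqP ky0 := ky.
suff : g (x - (k x / k y) *: y) = 0.
  by rewrite linearB linearZ /= gy scaler0 subr0.
apply: IH gys => h Wh hys.
pose l := dual_lincomb (- (h y / k y)) k h.
have lx : l x = 0.
  apply: Wx => [|z]; first exact: Wlincomb.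
  rewrite in_cons dual_lincombE => /predU1P[->|zys].
    by rewrite mulNr divfK// addNr.
  by rewrite (kys z)// (hys z)// mulr0 addr0.
rewrite dual_lincombE addrC in lx; rewrite -[RHS]lx linearB linearZ mulNr.
by congr (_ + - _); rewrite /GRing.scale /= [LHS]mulrC [RHS]mulrAC mulrA.
Qed.

(** To match [g] also at [y], add a multiple of some [k] in [W] that vanishes on
[ys] but not at [y]; if there is none, [separating_annihilator] shows that the
values at [y] already agree. *)
Lemma separating_interpolation (ys : seq X) (g : dual X) : W !=set0 ->
  exists2 f, W f & {in ys, forall y, f y = g y}.
Proof.
move=> [f0 Wf0]; elim: ys => [|y ys [f Wf fys]]; first by exists f0.
have [[k Wk [kys /eqP ky]]|nok] := pselect (exists2 k, W k &
    {in ys, forall z, k z = 0} /\ k y <> 0).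
  exists (dual_lincomb ((g y - f y) / k y) k f); first exact: Wlincomb.
  move=> z; rewrite in_cons dual_lincombE => /predU1P[->|zys].
    by rewrite divfK// subrK.
  by rewrite (kys z)// mulr0 add0r fys.
exists f => // z; rewrite in_cons => /predU1P[->|]; last exact: fys.
suff : dual_lincomb (- 1) f g y = 0.
  by rewrite dual_lincombE mulN1r addrC => /subr0_eq.
apply: (@separating_annihilator ys).
  by move=> h Wh hys; apply: contrapT => hy; apply: nok; exists h.
by move=> {}z zys; rewrite dual_lincombE fys// mulN1r addNr.
Qed.

Lemma separating_dense : W !=set0 -> dense (W : set (weak_star X)).
Proof.
move=> W0 O [g Og] oO.
(* in terms of a filter converging to [g], weak-star convergence can be checked
   at one point at a time *)
pose G : set_system (dual X) := filter_from [set: seq X]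
  (fun ys => [set f | W f /\ {in ys, forall y, f y = g y}]).
have GG : ProperFilter G.
  apply: filter_from_proper; last first.
    by move=> ys _; have [f] := separating_interpolation ys g W0; exists f.
  apply: filter_from_filter; first by exists [::].
  move=> ys zs _ _; exists (ys ++ zs) => // f [Wf fyz].
  by split; split => // y yin; apply: fyz; rewrite mem_cat yin ?orbT.
have Gg : G --> (g : weak_star X).
  apply/cvg_sup => x U [_ [[B oB <-] Bg BU]]; exists [:: x] => // f [Wf fx].
  by apply: BU; rewrite /preimage /= fx ?mem_head.
have GO : G O by apply: Gg; exact: open_nbhs_nbhs.
have GW : G W by exists [::] => // f [].
by have [f] := filter_ex (filterI GO GW); exists f.
Qed.

End interpolation.

(** * The Countable Separation Property *)

Lemma csp_of_dense_separable (X : completeNormedModType R) :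
  dense_separable (weak_star X) -> countable_separation_property X.
Proof.
move=> dsX F sF.
(* membership in the span of a finite list [s] of functionals, encoded as
   vanishing on the common zeros of [s] *)
pose supp (f : dual X) (s : seq (dual X)) := (forall h, h \in s -> F h) /\
  forall x, {in s, forall h : dual X, h x = 0} -> f x = 0.
pose W : set (dual X) := [set f | exists s, supp f s].
have FW f : F f -> W f.
  move=> Ff; exists [:: f]; split=> [h|x fx]; first by rewrite inE => /eqP ->.
  by apply: fx; rewrite mem_head.
have Wlincomb t h k : W h -> W k -> W (dual_lincomb t h k).
  move=> [s [sF1 sh]] [s' [sF2 sk]]; exists (s ++ s'); split=> [l|x lx].
    by rewrite mem_cat => /orP[/sF1|/sF2].
  rewrite dual_lincombE sh ?sk ?mulr0 ?addr0// => l ls; apply: lx.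
    by rewrite mem_cat ls orbT.
  by rewrite mem_cat ls.
have sW : separates_points W.
  apply/separates_pointsP => x x0.
  have /separates_pointsP/(_ x x0)[f Ff fx] := sF.
  by exists f => //; exact: FW.
have dW : dense (W : set (weak_star X)).
  have [[f Ff]|F0] := pselect (F !=set0).
    by apply: separating_dense => //; exists f; exact: FW.
  (* no member of [F] at all: [X] is trivial and every functional is zero *)
  move=> O [g Og] _; exists g; split=> //; exists [::]; split=> // x _.
  have [->|/eqP x0] := eqVneq x 0; first exact: linear0.
  have /separates_pointsP/(_ x x0)[f Ff] := sF.
  by case: F0; exists f.
have [S cS dS] := dsX W dW.
have [s sP] : {s : set_type (W : set (weak_star X)) -> seq (dual X) &
    forall f, supp (set_val f) (s f)}.
  by apply: (@choice _ _ (fun f => supp (set_val f))) => f; exact: (set_valP f).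
exists (\bigcup_(f in S) [set` s f]); split.
- by move=> h [f Sf] /= /(sP f).1.
- by apply: bigcup_countable => // f _; exact: finite_set_countable.
apply/separates_pointsP => x x0.
pose O := [set f : weak_star X | (f : dual X) x <> 0].
have [||f [Of Sf]] := dS (set_val @^-1` O).
- have /separates_pointsP/(_ x x0)[f Wf fx] := sW.
  by exists (SigSub (mem_set Wf)).
- have /continuousP := @initial_continuous _ _
    (set_val : set_type (W : set (weak_star X)) -> _).
  by apply; exact: open_weak_star_neq0.
apply: contrapT => no; apply: Of; apply: (sP f).2 => h hs.
by apply: contrapT => hx; apply: no; exists h => //; exists f.
Qed.

End weak_star.

Section property_C.
Context (R : realType).

Lemma closed_dual_preimage (X : normedModType R) (f : dual X) (D : set R^o) :
  closed D -> closed (f @^-1` D).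
Proof. by apply: preimage_closed => x _; exact: dual_continuous. Qed.

Lemma csp_of_property_C (X : completeNormedModType R) (S : set (dual X)) :
  corson_property_C X -> countable S -> separates_points S ->
  countable_separation_property X.
Proof.
move=> CX cS sS F sF.
(* half-spaces missing 0; the integer factor, of either sign, makes them cover
   all other points *)
pose H (gz : dual X * int) := [set x : X | 1 <= gz.2%:~R * gz.1 x].
have clH gz : closed (H gz).
  (* [z g], written as [(z - 1) g + g] *)
  have := @closed_dual_preimage _ (dual_lincomb (gz.2%:~R - 1) gz.1 gz.1) _
    (@closed_ge R 1).
  congr closed; apply/funext => x.
  by rewrite /H /preimage /mkset dual_lincombE mulrBl mul1r subrK.
have cvH gz : convex_set (H gz : set (convex_lmodType X)).
  apply/convex_setE => x y t t0 t1; rewrite /H /= => Hx Hy.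
  rewrite linearD !linearZ /= /GRing.scale /= mulrDr !(mulrCA gz.2%:~R).
  rewrite -[leLHS](subrK t 1) addrC -{1}[t]mulr1 -[1 - t in leLHS]mulr1.
  by rewrite lerD// ler_wpM2l// subr_ge0.
pose ker (f : dual X) := [set x | f x = 0].
(* property (C) for the half-space together with the kernels of [F]; putting the
   half-space itself into the family covers the case where [F] is empty *)
have HF gz : exists F1 : set (dual X), [/\ F1 `<=` F, countable F1 &
    forall x, H gz x -> exists2 f, F1 f & f x <> 0].
  have [||A0 [A0A cA0 A00]] := CX ([set H gz] `|` (ker @` F)).
  - move=> _ [->|[f Ff <-]]; first by split.
    split; first exact: (@closed_dual_preimage _ f _ (@closed_eq R 0)).
    apply/convex_setE => x y t _ _; rewrite /ker /= => fx fy.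
    by rewrite linearD !linearZ /= fx fy !scaler0 addr0.
  - apply/seteqP; split=> // x Ax; have Hx : H gz x by apply: Ax; left.
    have x0 : x <> 0.
      by move=> x0; move: Hx; rewrite x0 /H /= linear0 mulr0 ler10.
    have /separates_pointsP/(_ x x0)[f Ff] := sF.
    by apply; apply: (Ax (ker f)); right; exists f.
  have [F1 [F1F cF1 F1A0]] := countable_sub_image (@subIsetr _ A0 (ker @` F))
    (sub_countable (subset_card_le (@subIsetl _ _ _)) cA0).
  exists F1; split=> // x Hx; apply: contrapT => no.
  suff : (\bigcap_(C in A0) C) x by rewrite A00.
  move=> C A0C; have [->//|FC] := A0A _ A0C.
  have [f F1f <-] : (ker @` F1) C by rewrite F1A0.
  by apply: contrapT => fx; apply: no; exists f.
have {HF}[F1 F1P] := choice HF.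
exists (\bigcup_(gz in S `*` [set: int]) F1 gz); split.
- by move=> f [gz _] F1f; have [+ _ _] := F1P gz; exact.
- apply: bigcup_countable; last by move=> gz _; have [] := F1P gz.
  by apply: countableX => //; exact: countableP.
apply/separates_pointsP => x x0.
have /separates_pointsP/(_ x x0)[g Sg /eqP gx] := sS.
have [z zgx] : exists z : int, 1 <= z%:~R * g x.
  have [g0|g0|g0] := ltgtP (g x) 0; last by rewrite g0 eqxx in gx.
    exists (Num.floor (g x)^-1).
    by rewrite -[leLHS](mulVf gx) ler_wnM2r ?(ltW g0)// floor_le.
  exists (Num.ceil (g x)^-1).
  by rewrite -[leLHS](mulVf gx) ler_wpM2r ?(ltW g0)// ceil_ge.
have [_ _ /(_ x zgx)[f F1f fx]] := F1P (g, z).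
by exists f => //; exists (g, z).
Qed.

Lemma csp_c0_sum (X : nat -> completeNormedModType R) :
  (forall n, corson_property_C (X n)) ->
  (forall n, separable (weak_star (X n))) ->
  countable_separation_property (c0_sum X).
Proof.
move=> CX sX F sF.
(* density carries separation over from another family only; the restrictions
   of the members of [F] to the [n]-th summand are such a family *)
have sS n : exists S : set (dual (X n)), countable S /\ separates_points S.
  have [S cS dS] := sX n; exists S; split=> //.
  pose r (f : dual (c0_sum X)) := dual_comp f (@c0_single_continuous _ X n).
  apply: (@weak_star_dense_separates _ _ (r @` F)) dS.
  apply/separates_pointsP => a a0.
  have /separates_pointsP/(_ (c0_single a))[|f Ff fa] := sF.
    by move=> sa; apply: a0; rewrite -(c0_single_in a) sa.
  by exists (r f) => //; exists f.
have {sS}S n := cid (sS n).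
pose e n (g : dual (X n)) := dual_comp g (@c0_proj_continuous _ X n).
apply: (@csp_of_property_C _ (\bigcup_n (@e n @` projT1 (S n)))) => //.
- exact: c0_sum_property_C.
- apply: bigcup_countable => // n _.
  exact: sub_countable (card_image_le _ _) (projT2 (S n)).1.
apply/separates_pointsP => x x0.
have [n xn] : exists n, x n <> 0.
  apply: contrapT => /forallNP xn; apply: x0; apply: c0_sumP => n.
  exact: contrapT (xn n).
have /separates_pointsP/(_ _ xn)[g Sg gx] := (projT2 (S n)).2.
by exists (e n g) => //; exists n => //; exists g.
Qed.

End property_C.

Theorem proposition2p11 (R : realType) :
  (forall X : completeNormedModType R,
     dense_separable (weak_star X) -> countable_separation_property X) /\
  (forall X : nat -> completeNormedModType R,
     (forall n, corson_property_C (X n)) ->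
     (forall n, separable (weak_star (X n))) ->
     countable_separation_property (c0_sum X)).
Proof.
split; first exact: csp_of_dense_separable.
exact: csp_c0_sum.
Qed.
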